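(* Let $U$ be Friedman-reflexive with interpreter-selecting function ${\sf C}$, and let $A$ be a consistent finitely axiomatised theory with $U\not\rhd A$. Then $U+\neg{\sf C}(A)$ is consistent and not polyglot.
   Context: Theories are first-order theories in finite signature; interpretations may be multi-dimensional and piecewise; $W\rhd D$ means $W$ interprets $D$. A $U$-sentence $C$ is an interpreter of finitely axiomatised $A$ over $U$ iff for all $U$-sentences $B$: $(U+B)\rhd A$ iff $U+B\vdash C$; $U$ is Friedman-reflexive iff every finitely axiomatised $A$ has one, and ${\sf C}(A)$ denotes a chosen interpreter. $U$ is polyglot iff for every consistent finitely axiomatised $A$ there is a $U$-sentence $B$ with $(U+B)\rhd A$ and $U+B$ consistent. *)

(* Defs.v *)
From Stdlib Require List.
From mathcomp Require Import all_boot.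
Set Implicit Arguments.
Unset Strict Implicit.
Unset Printing Implicit Defensive.

Record signature := Signature {
  fsym : finType;
  farity : fsym -> nat;
  rsym : finType;
  rarity : rsym -> nat
}.

(* Syntax is well-scoped: the type V collects the variables allowed to occur
   free, and a quantifier binds the variable None of option V. *)
Inductive term (S : signature) (V : Type) : Type :=
| Var of V
| App (f : fsym S) of {ffun 'I_(farity f) -> term S V}.

Arguments Var {S V} _.
Arguments App {S V} f _.

Inductive form (S : signature) (V : Type) : Type :=
| Bot
| Eq of term S V & term S V
| Rel (R : rsym S) of {ffun 'I_(rarity R) -> term S V}
| Imp of form S V & form S V
| All of form S (option V).

Arguments Bot {S V}.
Arguments Eq {S V} _ _.
Arguments Rel {S V} R _.
Arguments Imp {S V} _ _.
Arguments All {S V} _.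

Definition Neg {S : signature} {V : Type} (a : form S V) : form S V :=
  Imp a Bot.
Definition Top {S : signature} {V : Type} : form S V := Neg Bot.
Definition And {S : signature} {V : Type} (a b : form S V) : form S V :=
  Neg (Imp a (Neg b)).
Definition Ex {S : signature} {V : Type} (a : form S (option V)) : form S V :=
  Neg (All (Neg a)).

Definition sentence (S : signature) := form S void.

Fixpoint tsubst {S : signature} {V W : Type} (s : V -> term S W)
    (t : term S V) : term S W :=
  match t with
  | Var v => s v
  | App f ts => App f [ffun i => tsubst s (ts i)]
  end.

Definition tren {S : signature} {V W : Type} (r : V -> W) :
    term S V -> term S W :=
  tsubst (fun v => Var (r v)).

Definition up {S : signature} {V W : Type} (s : V -> term S W) (x : option V) :
    term S (option W) :=
  if x is Some v then tren Some (s v) else Var None.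

Fixpoint fsubst {S : signature} {V W : Type} (s : V -> term S W)
    (a : form S V) : form S W :=
  match a with
  | Bot => Bot
  | Eq t u => Eq (tsubst s t) (tsubst s u)
  | Rel R ts => Rel R [ffun i => tsubst s (ts i)]
  | Imp b c => Imp (fsubst s b) (fsubst s c)
  | All b => All (fsubst (up s) b)
  end.

Definition fren {S : signature} {V W : Type} (r : V -> W) :
    form S V -> form S W :=
  fsubst (fun v => Var (r v)).

Definition inst {S : signature} {V : Type} (a : form S (option V))
    (t : term S V) : form S V :=
  fsubst (fun x => if x is Some v then Var v else t) a.

Inductive prv (S : signature) :
  forall V : Type, (form S V -> Prop) -> form S V -> Prop :=
| prv_hyp (V : Type) (G : form S V -> Prop) a : G a -> prv G a
| prv_impI (V : Type) (G : form S V -> Prop) a b :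
    prv (fun c => G c \/ c = a) b -> prv G (Imp a b)
| prv_impE (V : Type) (G : form S V -> Prop) a b :
    prv G (Imp a b) -> prv G a -> prv G b
| prv_dne (V : Type) (G : form S V -> Prop) a : prv G (Neg (Neg a)) -> prv G a
| prv_allI (V : Type) (G : form S V -> Prop) a :
    prv (fun c => exists2 b, G b & c = fren Some b) a -> prv G (All a)
| prv_allE (V : Type) (G : form S V -> Prop) a t :
    prv G (All a) -> prv G (inst a t)
| prv_refl (V : Type) (G : form S V -> Prop) t : prv G (Eq t t)
| prv_leib (V : Type) (G : form S V -> Prop) a t u :
    prv G (Eq t u) -> prv G (inst a t) -> prv G (inst a u)
  (* Domains are nonempty: the other rules do not give this when V is empty
     and there are no constants. *)
| prv_inhab (V : Type) (G : form S V -> Prop) :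
    prv G (Ex (Eq (Var None) (Var None))).

Definition theory (S : signature) := sentence S -> Prop.

Definition provable {S} (U : theory S) (B : sentence S) : Prop := prv U B.

Definition extend {S} (U : theory S) (B : sentence S) : theory S :=
  fun D => U D \/ D = B.

Definition consistent {S} (U : theory S) : Prop := ~ provable U Bot.

Definition finitely_axiomatised {S} (A : theory S) : Prop :=
  exists l : seq (sentence S), forall B, A B <-> List.In B l.

Fixpoint alls_ord {S : signature} {V : Type} (k : nat) :
    form S (V + 'I_k) -> form S V :=
  match k with
  | 0 => fun a =>
      fren (fun x : V + 'I_0 => match x with
                                | inl v => v
                                | inr i => match notF (ltn_ord i) with end
                                end) a
  | k'.+1 => fun a =>
      alls_ord (All (fren (fun x : V + 'I_k'.+1 =>
                             match x with
                             | inl v => Some (inl v)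
                             | inr i => omap inr (unlift ord0 i)
                             end) a))
  end.

Definition alls {S : signature} {V : Type} (K : finType) (a : form S (V + K)) :
    form S V :=
  alls_ord (fren (fun x => match x with
                           | inl v => inl v
                           | inr k => inr (enum_rank k)
                           end) a).

Definition exs {S : signature} {V : Type} (K : finType) (a : form S (V + K)) :
    form S V :=
  Neg (alls (Neg a)).

(* Elimination of function symbols: f becomes a relation symbol for its graph
   f(x_1, ..., x_n) = y, of arity n + 1 with y in the last place. *)
Definition relational (S : signature) : signature := {|
  fsym := void;
  farity := fun f => match f with end;
  rsym := (rsym S + fsym S)%type;
  rarity := fun R => match R with
                     | inl R => rarity R
                     | inr f => (farity f).+1
                     end
|}.

Definition as_var {S : signature} {V : Type} (t : term S V) : option V :=
  if t is Var v then Some v else None.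

(* The positions of the compound terms among the arguments ts; these get a
   fresh variable, while arguments that are variables are kept. *)
Definition compound {S : signature} {V : Type} {n : nat}
    (ts : {ffun 'I_n -> term S V}) : finType :=
  {i : 'I_n | ~~ as_var (ts i)}.

Definition slot {S : signature} {V : Type} {n : nat}
    (ts : {ffun 'I_n -> term S V}) (i : 'I_n) :
    V + compound ts :=
  match as_var (ts i) as o return (~~ o -> ~~ as_var (ts i)) -> _ with
  | Some v => fun=> inl v
  | None => fun h => inr (exist _ i (h isT))
  end id.

Definition slot_var {S : signature} {V W : Type} {n : nat} (r : V -> W)
    (ts : {ffun 'I_n -> term S V})
    (i : 'I_n) : term (relational S) (W + compound ts) :=
  Var match slot ts i with inl v => inl (r v) | inr k => inr k end.

(* The function-free formula expressing t = y. *)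
Fixpoint graph {S : signature} {V : Type} (t : term S V) :
    forall W : Type, (V -> W) -> W -> form (relational S) W :=
  match t with
  | Var v => fun W r y => Eq (Var (r v)) (Var y)
  | App f ts => fun W r y =>
      exs (K := compound ts)
        (And (\big[And/Top]_(k : compound ts)
                graph (ts (val k)) (fun v => inl (r v)) (inr k))
             (Rel (inr f : rsym (relational S))
                [ffun i : 'I_(farity f).+1 =>
                   if unlift ord_max i is Some j then slot_var r ts j
                   else Var (inl y)]))
  end.

Fixpoint unnest {S : signature} {V : Type} (a : form S V) : form
    (relational S) V :=
  match a with
  | Bot => Bot
  | Eq t (Var y) => graph t id y
  | Eq (Var y) u => graph u id y
  | Eq t u => Ex (And (graph t Some None) (graph u Some None))
  | Rel R ts =>
      exs (K := compound ts)
        (And (\big[And/Top]_(k : compound ts)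
                graph (ts (val k)) inl (inr k))
             (Rel (inl R : rsym (relational S)) [ffun i => slot_var id ts i]))
  | Imp b c => Imp (unnest b) (unnest c)
  | All b => All (unnest b)
  end.

(* A piecewise, multi-dimensional, relativised translation without parameters:
   the domain is the disjoint sum over the pieces p of the (dim p)-tuples
   satisfying dom p, and equality between such tuples is given by eqv. *)
Record translation (S T : signature) := Translation {
  piece : finType;
  dim : piece -> nat;
  dom : forall p : piece, form T 'I_(dim p);
  eqv : forall p q : piece, form T ('I_(dim p) + 'I_(dim q));
  relt : forall (R : rsym (relational S))
           (p : {ffun 'I_(rarity R) -> piece}),
         form T {i : 'I_(rarity R) & 'I_(dim (p i))}
}.

(* A variable of the source is sent to a piece with a tuple of variables. *)
Definition point {S T} (tau : translation S T) (W : Type) : Type :=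
  {p : piece tau & 'I_(dim p) -> W}.

Definition point_map {S T} {tau : translation S T} {W W' : Type} (r : W -> W')
    (x : point tau W) : point tau W' :=
  existT _ (tag x) (fun i => r (tagged x i)).

Definition var_of {S : signature} {V : Type} (t : term (relational S) V) : V :=
  match t with
  | Var v => v
  | App f _ => match (f : void) with end
  end.

Fixpoint trans {S T : signature} (tau : translation S T) {V : Type}
    (a : form (relational S) V) :
    forall W : Type, (V -> point tau W) -> form T W :=
  match a with
  | Bot => fun W r => Bot
  | Eq t u => fun W r =>
      fren (fun x => match x with
                     | inl i => tagged (r (var_of t)) i
                     | inr j => tagged (r (var_of u)) j
                     end)
        (eqv (tag (r (var_of t))) (tag (r (var_of u))))
  | Rel R ts => fun W r =>
      let p := [ffun i => tag (r (var_of (ts i)))] in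
      fren (fun x : {i : 'I_(rarity R) & 'I_(dim (p i))} =>
              tagged (r (var_of (ts (tag x))))
                (cast_ord (congr1 (@dim _ _ tau) (ffunE _ (tag x))) (tagged x)))
        (relt p)
  | Imp b c => fun W r => Imp (trans b r) (trans c r)
  | All b => fun W r =>
      \big[And/Top]_(p : piece tau)
        alls (K := 'I_(dim p))
          (Imp (fren inr (dom p))
             (trans b (fun x => if x is Some v then point_map inl (r v)
                                else existT _ p inr)))
  end.

Definition translate {S T} (tau : translation S T) (B : sentence S) :
    sentence T :=
  trans (unnest B) (fun v : void => match v with end : point tau void).

Definition interprets {S T} (W : theory T) (D : theory S) : Prop :=
  exists tau : translation S T,
    forall B : sentence S, provable D B -> provable W (translate tau B).

Definition interpreter {S T} (U : theory S) (A : theory T) (C : sentence S) :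
    Prop :=
  forall B : sentence S,
    interprets (extend U B) A <-> provable (extend U B) C.

Definition friedman_reflexive {S} (U : theory S) : Prop :=
  forall (T : signature) (A : theory T), finitely_axiomatised A ->
    exists C : sentence S, interpreter U A C.

(* The values of C at theories that are not finitely axiomatised are junk. *)
Definition interpreter_selector {S} (U : theory S)
    (C : forall T : signature, theory T -> sentence S) : Prop :=
  forall (T : signature) (A : theory T), finitely_axiomatised A ->
    interpreter U A (C T A).

Definition polyglot {S} (U : theory S) : Prop :=
  forall (T : signature) (A : theory T),
    finitely_axiomatised A -> consistent A ->
    exists B : sentence S,
      interprets (extend U B) A /\ consistent (extend U B).

(* Main.v *)
From mathcomp Require Import all_boot.
Require Import Defs.

(** Write $c$ for ${\sf C}(A)$. If $U+\neg c$ were inconsistent, classical logic would give $U\vdash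
    c$, hence $U\rhd A$ ([interprets_of_provable_interpreter]), against the assumption. Polyglotness
    fails at $A$ itself: if $U+\neg c+B$ interprets $A$, so does $U+(\neg c\wedge B)$, which then
    proves $c$ by the interpreter property and $\neg c$ by its axiom. The propositional lemmas serve
    to merge the two added axioms into one ([provable_extend_And]). *)

Lemma prv_weaken (S : signature) (V : Type) (G H : form S V -> Prop) a :
  (forall c, G c -> H c) -> prv G a -> prv H a.
Proof.
(* [H] stays general, since the introduction rules for [Imp] and [All] change the context. *)
move=> sGH pr; elim: pr H sGH => {V G a}.
- by move=> V G a Ga H sGH; apply/prv_hyp/sGH.
- move=> V G a b _ IH H sGH; apply/prv_impI/IH => c [/sGH | ->]; by [left | right].
- by move=> V G a b _ IHab _ IHa H sGH; apply: prv_impE (IHab _ sGH) (IHa _ sGH).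
- by move=> V G a _ IH H sGH; apply/prv_dne/IH.
- move=> V G a _ IH H sGH; apply/prv_allI/IH => c [b /sGH Hb ->]; by exists b.
- by move=> V G a t _ IH H sGH; apply/prv_allE/IH.
- by move=> V G t H _; apply: prv_refl.
- by move=> V G a t u _ IHtu _ IHa H sGH; apply: prv_leib (IHtu _ sGH) (IHa _ sGH).
- by move=> V G H _; apply: prv_inhab.
Qed.

Section Provability.
Context {S : signature}.
Implicit Types (U : theory S) (B D E : sentence S).

Lemma provable_extend U B D : provable U D -> provable (extend U B) D.
Proof. by apply: prv_weaken => c; left. Qed.

Lemma provable_extend_self U B : provable (extend U B) B.
Proof. by apply: prv_hyp; right. Qed.

Lemma provable_cut U B D :
  provable U B -> provable (extend U B) D -> provable U D.
Proof. by move=> pB /prv_impI pBD; apply: prv_impE pBD pB. Qed.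

Lemma provable_exfalso U B : provable U Bot -> provable U B.
Proof. by move=> p; apply/prv_dne/prv_impI/provable_extend. Qed.

Lemma provable_by_contradiction U B :
  provable (extend U (Neg B)) Bot -> provable U B.
Proof. by move=> p; apply/prv_dne/prv_impI. Qed.

Lemma provable_Top U : provable U Top.
Proof. exact/prv_impI/provable_extend_self. Qed.

Lemma provable_AndI U B D :
  provable U B -> provable U D -> provable U (And B D).
Proof.
move=> pB pD; apply: prv_impI; apply: prv_impE (provable_extend _ _ _ pD).
exact: prv_impE (provable_extend_self _ _) (provable_extend _ _ _ pB).
Qed.

Lemma provable_AndEl U B D : provable U (And B D) -> provable U B.
Proof.
move=> pBD; apply: provable_by_contradiction.
(* [And B D] unfolds to [Neg (Imp B (Neg D))], and [Neg B] makes the inner implication vacuous. *)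
apply: prv_impE (provable_extend _ _ _ pBD) _; apply/prv_impI/provable_exfalso.
exact: prv_impE (provable_extend _ _ _ (provable_extend_self _ _))
                (provable_extend_self _ _).
Qed.

Lemma provable_AndEr U B D : provable U (And B D) -> provable U D.
Proof.
move=> pBD; apply: provable_by_contradiction.
apply: prv_impE (provable_extend _ _ _ pBD) _.
exact/prv_impI/provable_extend/provable_extend_self.
Qed.

(** An interpreter is tested only on extensions of $U$ by a single sentence, so iterated extensions
    must be brought to that form. *)
Lemma provable_extend_And U B D E :
  provable (extend (extend U B) D) E <-> provable (extend U (And B D)) E.
Proof.
split=> [p | /prv_impI p].
  have pBD := provable_extend_self U (And B D).
  apply: prv_impE (provable_AndEr _ _ _ pBD).
  apply: prv_impE (provable_AndEl _ _ _ pBD).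
  exact/provable_extend/prv_impI/prv_impI.
apply: prv_impE (provable_extend _ _ _ (provable_extend _ _ _ p)) _.
apply: provable_AndI (provable_extend_self _ _).
exact/provable_extend/provable_extend_self.
Qed.

(** The same translation works, as only the theorems of the interpreting theory matter. *)
Lemma interprets_mono {T : signature} (U W : theory S) (A : theory T) :
  (forall B, provable U B -> provable W B) -> interprets U A -> interprets W A.
Proof. by move=> sUW [tau tauP]; exists tau => B /tauP/sUW. Qed.

Lemma interprets_of_provable_interpreter {T : signature} U (A : theory T) C :
  interpreter U A C -> provable U C -> interprets U A.
Proof.
(* [Top] is a harmless axiom that puts $U$ itself within reach of the interpreter property. *)
move=> CP /(provable_extend U Top)/CP; apply: interprets_mono => B.
exact/provable_cut/provable_Top.
Qed.

End Provability.

Theorem theorem4p2 (S : signature) (U : theory S)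
    (C : forall T : signature, theory T -> sentence S)
    (hU : friedman_reflexive U) (hC : interpreter_selector U C)
    (T : signature) (A : theory T)
    (hAfin : finitely_axiomatised A) (hAcons : consistent A)
    (hUA : ~ interprets U A) :
  consistent (extend U (Neg (C T A))) /\
  ~ polyglot (extend U (Neg (C T A))).
Proof.
have CP := hC T A hAfin; split.
  move=> /provable_by_contradiction.
  by move=> /(interprets_of_provable_interpreter _ _ _ CP).
(* A itself is the theory on which U + ~ C(A) fails to be polyglot. *)
move=> /(_ T A hAfin hAcons) [B [iA]]; apply; apply/provable_extend_And.
have pNB := provable_extend_self U (And (Neg (C T A)) B).
(* The left conjunct refutes [C T A], so it remains to prove [C T A], which [CP] turns into
   interpreting [A]. *)
apply: prv_impE (provable_AndEl _ _ _ pNB) _; apply/CP.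
by apply: interprets_mono iA => D /provable_extend_And.
Qed.
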